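(* Let $\mathcal N$ be an admissible algebra, $\pi$ an admissible projection on $\mathcal N$ and $S:=S_\pi$. For every $D\in\mathrm{End}(\mathcal N)$ the following conditions are equivalent. (i) $D\in\mathrm{der}(\mathcal N)$. (ii) $D-v\in\mathrm{aff}(S)$ for some $v\in\mathcal N$. Furthermore, the vector $v=v_{D,\pi}$ in (ii) is uniquely determined by $D$ and coincides with the unique element $v$ in $T_0S=\ker\pi$ satisfying $[\pi,D]=\pi\circ M_v$. Also $D\mapsto D-v_{D,\pi}$ induces a Lie algebra isomorphism $\mathrm{der}(\mathcal N)\to\mathrm{aff}(S)$.
   Context: $\mathbb F$ is a field of characteristic $0$; all algebras are associative $\mathbb F$-algebras. An admissible algebra is a commutative nilpotent algebra $\mathcal N$ of finite dimension over $\mathbb F$ whose annihilator $\mathcal N_{[1]}=\{x\in\mathcal N:x\mathcal N=0\}$ has dimension $1$. An admissible projection is a linear map $\pi=\pi^2\in\mathrm{End}(\mathcal N)$ with range $\mathcal N_{[1]}$. Put $\exp_1(x)=\sum_{k\ge1}x^k/k!$ for $x\in\mathcal N$ and $S_\pi:=\{x\in\mathcal N:\pi(\exp_1x)=0\}$. $\mathcal N^0=\mathbb F\cdot\mathbf 1\oplus\mathcal N$ is the unital extension, $\exp(x)=\mathbf 1+\exp_1(x)\in\mathcal N^0$, and for $e\in\mathcal N^0$, $M_e\in\mathrm{End}(\mathcal N)$ is $M_e(x)=ex$. For $x\in S$ the tangent space is $T_x(S):=\ker(\pi\circ M_{\exp x})$, the kernel of the formal derivative at $x$ of $\pi\circ\exp_1$.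 $\mathrm{aff}(S)$ is the space of all affine maps $A:\mathcal N\to\mathcal N$ with $A(x)\in T_x(S)$ for all $x\in S$; it is a Lie algebra with respect to $[A,B]=A'\circ B-B'\circ A$, where $A'=A-A(0)$ is the linear part of $A$. $\mathrm{der}(\mathcal N)$ is the Lie algebra of all derivations of $\mathcal N$ with the commutator bracket. $D-v$ denotes the affine map $x\mapsto D(x)-v$, and $[\pi,D]=\pi\circ D-D\circ\pi$. *)

(* Defs.v *)
From HB Require Import structures.
From mathcomp Require Import all_boot all_order all_algebra.
Set Implicit Arguments.
Unset Strict Implicit.
Unset Printing Implicit Defensive.
Import GRing.Theory.
Local Open Scope ring_scope.

Section LieAlgebras.
Context {F : fieldType}.

(* The elements of L satisfying P form a Lie algebra over F for the bracket
   br. *)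
Definition lie_algebra (L : lmodType F) (P : L -> Prop) (br : L -> L -> L) :
    Prop :=
  [/\ P 0 /\ (forall a x y, P x -> P y -> P (a *: x + y)),
      forall x y, P x -> P y -> P (br x y),
      (forall a x y z, P x -> P y -> P z ->
         br (a *: x + y) z = a *: br x z + br y z /\
         br z (a *: x + y) = a *: br z x + br z y),
      forall x, P x -> br x x = 0
    & forall x y z, P x -> P y -> P z ->
        br x (br y z) + br y (br z x) + br z (br x y) = 0].

(* f, restricted to the Lie algebra P, is an isomorphism onto the Lie
   algebra Q; the values of f outside P are irrelevant. *)
Definition lie_isomorphism (L L' : lmodType F)
    (P : L -> Prop) (br : L -> L -> L)
    (Q : L' -> Prop) (br' : L' -> L' -> L') (f : L -> L') : Prop :=
  [/\ lie_algebra P br /\ lie_algebra Q br',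
      forall x, P x -> Q (f x),
      forall a x y, P x -> P y -> f (a *: x + y) = a *: f x + f y,
      forall x y, P x -> P y -> f (br x y) = br' (f x) (f y)
    & (forall x y, P x -> P y -> f x = f y -> x = y) /\
      (forall y, Q y -> exists2 x, P x & f x = y)].

End LieAlgebras.

Section AffineMaps.
Context {F : fieldType} {N : vectType F}.

(* The pair (f, w) stands for the affine map x |-> f x + w; see affmap0,
   affmap_lin, affmap_inj and affmap_surj. *)
Definition affmap : vectType F := ('End(N) * N)%type.

Definition affmap_fun (A : affmap) (x : N) : N := A.1 x + A.2.

Definition lin_part (A : affmap) : 'End(N) := A.1.

Definition affsub (D : 'End(N)) (v : N) : affmap := (D, - v).

Definition lin_aff_comp (f : 'End(N)) (A : affmap) : affmap :=
  ((f \o A.1)%VF, f A.2).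

Definition aff_bracket (A B : affmap) : affmap :=
  lin_aff_comp (lin_part A) B - lin_aff_comp (lin_part B) A.

Definition commutator (f g : 'End(N)) : 'End(N) := (f \o g)%VF - (g \o f)%VF.

Lemma affmap0 A : affmap_fun A 0 = A.2.
Proof. by rewrite /affmap_fun linear0 add0r. Qed.

Lemma affmap_lin A x : lin_part A x = affmap_fun A x - affmap_fun A 0.
Proof. by rewrite affmap0 addrK. Qed.

Lemma affmap_inj A B : affmap_fun A =1 affmap_fun B -> A = B.
Proof.
move=> eAB; apply/eqP; rewrite /eq_op /= -!affmap0 eAB eqxx andbT; apply/eqP.
by apply/lfunP=> x; have := affmap_lin A x; rewrite !eAB -affmap_lin.
Qed.

Lemma affmap_surj (A : N -> N) :
    (forall a x y,
       A (a *: x + y) - A 0 = a *: (A x - A 0) + (A y - A 0)) ->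
  exists B : affmap, affmap_fun B =1 A.
Proof.
move=> linA; pose g x := A x - A 0.
pose gM := GRing.isLinear.Build F N N _ g linA.
pose gL : {linear N -> N} := HB.pack g gM.
by exists (linfun gL, A 0) => x; rewrite /affmap_fun lfunE /= subrK.
Qed.

Lemma affsubE D v x : affmap_fun (affsub D v) x = D x - v.
Proof. by []. Qed.

Lemma lin_aff_compE f A x :
  affmap_fun (lin_aff_comp f A) x = f (affmap_fun A x).
Proof. by rewrite /affmap_fun /= comp_lfunE linearD. Qed.

Lemma aff_bracketE A B x : affmap_fun (aff_bracket A B) x =
  lin_part A (affmap_fun B x) - lin_part B (affmap_fun A x).
Proof.
by rewrite -!lin_aff_compE /affmap_fun /= add_lfunE opp_lfunE opprD addrACA.
Qed.

End AffineMaps.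

Arguments affmap {F} N.

(* An algebra structure on the vector space N is its bilinear product,
   given in curried form: mul x y is the product of x and y. *)
Section Algebras.
Context {F : fieldType} {N : vectType F} (mul : 'Hom(N, 'End(N))).

(* All products x_0 x_1 ... x_k vanish, for some k. *)
Definition nilpotent_alg : Prop :=
  exists k : nat, forall (x : N) (s : seq N),
    size s = k -> foldl (fun y z => mul y z) x s = 0.

Definition annihilator : {vspace N} := lker mul.

Lemma annihilatorP x : reflect (forall y, mul x y = 0) (x \in annihilator).
Proof.
rewrite memv_ker; apply: (iffP eqP) => [-> y | mx0].
  by rewrite zero_lfunE.
by apply/lfunP=> y; rewrite mx0 zero_lfunE.
Qed.

Definition admissible : Prop :=
  [/\ forall x y z, mul x (mul y z) = mul (mul x y) z,
      forall x y, mul x y = mul y x,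
      nilpotent_alg
    & \dim annihilator = 1%N].

Definition admissible_proj (pi : 'End(N)) : Prop :=
  (pi \o pi)%VF = pi /\ limg pi = annihilator.

Definition derivation (D : 'End(N)) : Prop :=
  forall x y, D (mul x y) = mul (D x) y + mul x (D y).

(* The power x^k, meaningful for k > 0 only. *)
Definition npow (x : N) (k : nat) : N := iter k.-1 (mul x) x.

(* In a commutative nilpotent algebra of dimension d the powers x^k with k > d
   vanish, so the exponential series stops at k = d; see npow_eq0, exp1E. *)
Definition exp1 (x : N) : N :=
  \sum_(1 <= k < (\dim {:N}).+1) (k`!%:R)^-1 *: npow x k.

(* The unital extension F 1 (+) N; (a, x) stands for a 1 + x. *)
Definition unital_ext : vectType F := (F^o * N)%type.

Definition uext_mul (e f : unital_ext) : unital_ext :=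
  (e.1 * f.1, e.1 *: f.2 + f.1 *: e.2 + mul e.2 f.2).

Definition uext_inj (x : N) : unital_ext := (0, x).

Definition exp (x : N) : unital_ext := (1, exp1 x).

Definition mulop (e : unital_ext) : 'End(N) := e.1 *: \1%VF + mul e.2.

Lemma mulopE e x : uext_inj (mulop e x) = uext_mul e (uext_inj x).
Proof.
by rewrite /uext_mul /uext_inj /= mulr0 scale0r addr0 add_lfunE scale_lfunE
  id_lfunE.
Qed.

Definition Spi (pi : 'End(N)) : pred N := [pred x | pi (exp1 x) == 0].

Definition tangent (pi : 'End(N)) (x : N) : {vspace N} :=
  lker (pi \o mulop (exp x))%VF.

Definition aff (pi : 'End(N)) (A : affmap N) : Prop :=
  forall x, x \in Spi pi -> affmap_fun A x \in tangent pi x.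

Lemma npow_eq0 x k :
    (forall y z, mul y z = mul z y) -> nilpotent_alg ->
  (\dim {:N} < k)%N -> npow x k = 0.
Proof.
move=> mulC [m nilN]; case: k => // k; rewrite ltnS /npow /= => le_dk.
pose U j := iter j (fun V => (mul x @: V)%VS) {:N}%VS.
have UP j y : iter j (mul x) y \in U j.
  by elim: j => [|j IHj] /=; rewrite ?memvf ?memv_img.
have sU j : (U j.+1 <= U j)%VS.
  by elim: j => [|j IHj]; rewrite ?subvf //; apply: limgS.
have Um0 : U m = 0%VS.
  apply/eqP; rewrite -subv0; apply/subvP=> y.
  have: y \in U m -> exists z, y = iter m (mul x) z.
    elim: {nilN}m y => [|j IHj] y; first by exists y.
    by case/memv_imgP=> z /IHj[t ->] ->; exists t.
  move/[apply]=> -[z ->]; rewrite memv0; apply/eqP.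
  rewrite -(nilN z (nseq m x)) ?size_nseq //.
  elim: {nilN}m z => // j IHj z; rewrite iterSr IHj /=.
  by rewrite [mul z x]mulC.
have stab j : U j.+1 = U j -> U j = 0%VS.
  move=> eU; have eUi i : U (i + j)%N = U j.
    by elim: i => // i IHi; rewrite addSn -[RHS]eU /= -/(U _) IHi.
  have [le_mj | /ltnW le_jm] := leqP m j; last by rewrite -(eUi (m - j)%N) subnK.
  rewrite -(subnK le_mj); elim: (j - m)%N => // i IHi.
  by rewrite addSn /= -/(U _) IHi limg0.
have dimU j : (U j == 0%VS) || (\dim (U j) + j <= \dim {:N})%N.
  elim: j => [|j IHj]; first by rewrite addn0 leqnn orbT.
  have [/eqP Uj0 | Uj0] := boolP (U j == 0%VS).
    by rewrite /= -/(U j) Uj0 limg0 eqxx.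
  rewrite (negPf Uj0) /= in IHj; apply/orP; right.
  rewrite addnS; apply: leq_trans IHj; rewrite -addSn leq_add2r.
  rewrite (ltn_leqif (dimv_leqif_eq (sU j))).
  by apply: contra Uj0 => /eqP/stab ->.
have := UP k x; have /orP[/eqP-> | le_Uk] := dimU k; first by rewrite memv0 => /eqP.
have: \dim (U k) == 0%N by rewrite -leqn0 -(leq_add2r k) (leq_trans le_Uk).
by rewrite dimv_eq0 => /eqP->; rewrite memv0 => /eqP.
Qed.

Lemma exp1E x n :
    (forall y z, mul y z = mul z y) -> nilpotent_alg -> (\dim {:N} <= n)%N ->
  exp1 x = \sum_(1 <= k < n.+1) (k`!%:R)^-1 *: npow x k.
Proof.
move=> mulC nilN le_dn; rewrite (@big_cat_nat _ _ _ (\dim {:N}).+1) //=.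
rewrite [X in _ + X]big_nat_cond [X in _ + X]big1 ?addr0 //.
by move=> k /andP[/andP[lt_dk _] _]; rewrite npow_eq0 // scaler0.
Qed.

End Algebras.

(* Main.v *)
(* Write pi x = psi x a with a spanning the annihilator; a nonzero ideal meets
   the annihilator, so x = 0 as soon as psi x = 0 and psi (x N) = 0.
   Since S is parametrized by y |-> y - psi (exp1 y) a, the map D - v lies in
   aff(S) iff psi (exp y (D y - psi (exp1 y) D a - v)) = 0 for all y. Along a
   line t y this is an identity between polynomials in t. Comparing degrees
   gives D a in F a; then the coefficient of t^(k+1) reads
   psi (D (y^(k+1))) = (k+1) psi (y^k D y). For k = 1 and 2, polarization gives
   psi (u) = 0 and psi (u z) = 0 for u = D (x y) - (D x) y - x (D y), so D is a
   derivation. Conversely a derivation satisfies D (exp1 x) = exp x (D x), and v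
   is obtained by representing the functional psi (D x) - psi (D a) psi x. *)
Require Import Defs.
From HB Require Import structures.
From mathcomp Require Import all_boot all_order all_algebra.
From mathcomp Require Import ring.
Set Implicit Arguments.
Unset Strict Implicit.
Unset Printing Implicit Defensive.
Import GRing.Theory.
Local Open Scope ring_scope.

(** * Consequences of characteristic zero *)

Section CharacteristicZero.
Context {F : fieldType}.
Hypothesis charF0 : [pchar F] =i pred0.

Lemma natrS_neq0 n : n.+1%:R != 0 :> F.
Proof. by rewrite ((pcharf0P F).1 charF0). Qed.

Lemma fact_neq0 n : n`!%:R != 0 :> F.
Proof. by rewrite ((pcharf0P F).1 charF0) -lt0n fact_gt0. Qed.

Lemma invf_factS n : n.+1%:R * (n.+1`!%:R)^-1 = (n`!%:R)^-1 :> F.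
Proof.
by rewrite factS natrM invfM mulrA divff ?natrS_neq0 // mul1r.
Qed.

Lemma natr_inj_pchar0 : injective (fun n : nat => n%:R : F).
Proof.
have le_inj m n : (m <= n)%N -> m%:R = n%:R :> F -> m = n.
  move=> le_mn /eqP; rewrite eq_sym -subr_eq0 -natrB // ((pcharf0P F).1 charF0).
  by rewrite subn_eq0 => le_nm; apply/eqP; rewrite eqn_leq le_mn.
by move=> m n; case: (leqP m n) => [/le_inj // | /ltnW/le_inj eq_nm /esym/eq_nm].
Qed.

(** The images of 0, ..., size p - 1 in F are distinct, too many roots for a nonzero p. *)
Lemma poly_horner_eq0 (p : {poly F}) : (forall t, p.[t] = 0) -> p = 0.
Proof.
move=> p0; apply/eqP/contraT => nz_p.
have := @max_poly_roots _ p [seq n%:R | n <- iota 0 (size p)] nz_p.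
rewrite size_map size_iota ltnn; apply.
  by apply/allP=> t _; apply/rootP.
by rewrite map_inj_uniq ?iota_uniq //; apply: natr_inj_pchar0.
Qed.

End CharacteristicZero.

(** With A = [T x x y] and B = [T x y y], the diagonal at x + y and x + 2y gives 3A + 3B = 0 and 6A
    + 12B = 0, hence 6B = 0. Expanding [T x] at y + z then leaves 2 [T x y z] = 0. *)
Lemma trilinear_polarization {F : fieldType} {V : zmodType} (T : V -> V -> V -> F) :
    [pchar F] =i pred0 ->
    (forall x x' y z, T (x + x') y z = T x y z + T x' y z) ->
    (forall x y z, T x y z = T y x z) -> (forall x y z, T x y z = T x z y) ->
    (forall x, T x x x = 0) ->
  forall x y z, T x y z = 0.
Proof.
move=> charF0 TD TC12 TC23 T0.
have TD2 x y y' z : T x (y + y') z = T x y z + T x y' z.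
  by rewrite TC12 TD !(TC12 x).
have TD3 x y z z' : T x y (z + z') = T x y z + T x y z'.
  by rewrite TC23 TD2 !(TC23 x y).
have natr_inj (n : nat) (c : F) : n.+1%:R * c = 0 -> c = 0.
  by move/eqP; rewrite mulf_eq0 (negPf (natrS_neq0 charF0 _)) => /eqP.
have Txyy x y : T x y y = 0.
  have Tyxy : T y x y = T x y y by rewrite TC12.
  have Tyyx : T y y x = T x y y by rewrite TC23.
  have Tyxx : T y x x = T x x y by rewrite TC12 TC23.
  have Txyx : T x y x = T x x y by rewrite TC23.
  have := T0 (x + y + y); have := T0 (x + y).
  rewrite !(TD, TD2, TD3) !T0 Tyxy Tyyx Tyxx Txyx.
  set A := T x x y; set B := T x y y => e1 e2; apply: (natr_inj 5%N).
  have {}e1 : 3%:R * A + 3%:R * B = 0 by rewrite -[RHS]e1; ring.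
  have {}e2 : 6%:R * A + 12%:R * B = 0 by rewrite -[RHS]e2; ring.
  have -> : 6%:R * B = 6%:R * A + 12%:R * B - 2%:R * (3%:R * A + 3%:R * B).
    by ring.
  by rewrite e1 e2 mulr0 subrr.
move=> x y z; apply: (natr_inj 1%N); have := Txyy x (y + z).
by rewrite !(TD2, TD3) !Txyy add0r addr0 (TC23 x z y) => <-; ring.
Qed.

(** * Lie brackets of endomorphisms and of affine maps *)

Section AbelianGroup.
Variable V : zmodType.

(* The summands are the six products of three operators, as they are grouped in
   the Jacobi identity. *)
Lemma jacobi_sum (a b c d e f : V) :
  a - b - (c - d) + (c - e - (f - b)) + (f - d - (a - e)) = 0.
Proof.
rewrite !opprB !addrA.
rewrite [LHS](ACl (1 * 12 * (2 * 7) * (3 * 10) * (4 * 5) * (6 * 11) * (8 * 9)))/=.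
by rewrite !subrr !addNr !addr0.
Qed.

End AbelianGroup.
Section LieBrackets.
Context {F : fieldType} {N : vectType F}.
Implicit Types (f g h : 'End(N)) (A B C : affmap N).

Lemma commutatorE f g x : commutator f g x = f (g x) - g (f x).
Proof. by rewrite /commutator add_lfunE opp_lfunE !comp_lfunE. Qed.

Lemma commutator_linearl c f g h :
  commutator (c *: f + g) h = c *: commutator f h + commutator g h.
Proof.
rewrite /commutator comp_lfunDl comp_lfunDr -comp_lfunZl -comp_lfunZr.
by rewrite scalerBr opprD addrACA.
Qed.

Lemma commutator_anti f g : commutator f g = - commutator g f.
Proof. by rewrite /commutator opprB. Qed.

Lemma commutatorxx f : commutator f f = 0.
Proof. exact: subrr. Qed.

Lemma commutator_jacobi f g h :
  commutator f (commutator g h) + commutator g (commutator h f) +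
    commutator h (commutator f g) = 0.
Proof.
apply/lfunP=> x; rewrite 2!add_lfunE zero_lfunE !commutatorE.
rewrite [f (_ - _)]linearB [g (_ - _)]linearB [h (_ - _)]linearB /=.
exact: jacobi_sum.
Qed.

Lemma affmap_affsub A : A = affsub A.1 (- A.2).
Proof. by case: A => f u; rewrite /affsub opprK. Qed.

Lemma affsub0 : affsub 0 0 = 0 :> affmap N.
Proof. by rewrite /affsub oppr0. Qed.

Lemma affsubD f g (v w : N) : affsub f v + affsub g w = affsub (f + g) (v + w).
Proof. by rewrite /affsub opprD. Qed.

Lemma affsubZ c f (v : N) : c *: affsub f v = affsub (c *: f) (c *: v).
Proof. by rewrite /affsub -scalerN. Qed.

Lemma aff_bracket_affsub f g v w :
  aff_bracket (affsub f v) (affsub g w) = affsub (commutator f g) (f w - g v).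
Proof.
rewrite -[LHS]/(commutator f g, f (- w) - g (- v)) /affsub.
by rewrite [f _]linearN [g _]linearN /= opprK opprB addrC.
Qed.

Lemma aff_bracket_linearl c A B C :
  aff_bracket (c *: A + B) C = c *: aff_bracket A C + aff_bracket B C.
Proof.
apply: affmap_inj => x; rewrite aff_bracketE.
have affD (A1 A2 : affmap N) : affmap_fun (c *: A1 + A2) x
    = c *: affmap_fun A1 x + affmap_fun A2 x.
  by rewrite /affmap_fun /= add_lfunE scale_lfunE scalerDr addrACA.
rewrite !affD !aff_bracketE /lin_part /= linearP add_lfunE scale_lfunE.
by rewrite scalerBr opprD addrACA.
Qed.

Lemma aff_bracket_anti A B : aff_bracket A B = - aff_bracket B A.
Proof. by rewrite /aff_bracket opprB. Qed.

Lemma aff_bracketxx A : aff_bracket A A = 0.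
Proof. exact: subrr. Qed.

(** The linear parts obey [commutator_jacobi]; the translation parts are products of two linear
    parts applied to a vector, with the same six-term cancellation. *)
Lemma aff_bracket_jacobi A B C :
  aff_bracket A (aff_bracket B C) + aff_bracket B (aff_bracket C A) +
    aff_bracket C (aff_bracket A B) = 0.
Proof.
rewrite (affmap_affsub A) (affmap_affsub B) (affmap_affsub C).
rewrite !aff_bracket_affsub !affsubD commutator_jacobi !commutatorE.
rewrite [A.1 (_ - _)]linearB [B.1 (_ - _)]linearB [C.1 (_ - _)]linearB /=.
by rewrite jacobi_sum affsub0.
Qed.

Lemma lie_algebra_commutator (P : 'End(N) -> Prop) :
    P 0 -> (forall c f g, P f -> P g -> P (c *: f + g)) ->
    (forall f g, P f -> P g -> P (commutator f g)) ->
  lie_algebra P commutator.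
Proof.
move=> P0 PD Pbr; split=> // [c f g h _ _ _ | f _ | f g h _ _ _].
- rewrite commutator_linearl; split=> //.
  by rewrite !(commutator_anti h) commutator_linearl opprD scalerN.
- exact: commutatorxx.
exact: commutator_jacobi.
Qed.

Lemma lie_algebra_aff_bracket (P : affmap N -> Prop) :
    P 0 -> (forall c A B, P A -> P B -> P (c *: A + B)) ->
    (forall A B, P A -> P B -> P (aff_bracket A B)) ->
  lie_algebra P aff_bracket.
Proof.
move=> P0 PD Pbr; split=> // [c A B C _ _ _ | A _ | A B C _ _ _].
- rewrite aff_bracket_linearl; split=> //.
  by rewrite !(aff_bracket_anti C) aff_bracket_linearl opprD scalerN.
- exact: aff_bracketxx.
exact: aff_bracket_jacobi.
Qed.

End LieBrackets.

(** * Powers and their first variation along a line *)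

Section Powers.
Context {F : fieldType} {N : vectType F} (mul : 'Hom(N, 'End(N))).
Local Notation "x ** y" := (mul x y) (at level 40, left associativity).

Lemma mulND x y z : (x + y) ** z = x ** z + y ** z.
Proof. by rewrite linearD add_lfunE. Qed.

Lemma mulNZ t x z : (t *: x) ** z = t *: (x ** z).
Proof. by rewrite linearZ scale_lfunE. Qed.

Lemma mulNB x y z : (x - y) ** z = x ** z - y ** z.
Proof. by rewrite linearB add_lfunE opp_lfunE. Qed.

(* [mulpow x k] is multiplication by x^k, also when k = 0. *)
Definition mulpow (x : N) (k : nat) : 'End(N) :=
  iter k (fun f => (mul x \o f)%VF) \1%VF.

Arguments mulpow : simpl never.

Lemma mulpow0 x z : mulpow x 0 z = z.
Proof. by rewrite /mulpow /= id_lfunE. Qed.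

Lemma mulpowS x k z : mulpow x k.+1 z = x ** mulpow x k z.
Proof. by rewrite /mulpow /= comp_lfunE. Qed.

Lemma mulpow1 x z : mulpow x 1 z = x ** z.
Proof. by rewrite mulpowS mulpow0. Qed.

Lemma mulpowSr x k z : mulpow x k.+1 z = mulpow x k (x ** z).
Proof. by elim: k => [|k IHk]; rewrite mulpowS ?mulpow0 // IHk -mulpowS. Qed.

Lemma mulpowD x j k z : mulpow x (j + k) z = mulpow x j (mulpow x k z).
Proof. by elim: j => [|j IHj]; rewrite ?mulpow0 // addSn !mulpowS IHj. Qed.

Lemma mulpowZ t x k z : mulpow (t *: x) k z = t ^+ k *: mulpow x k z.
Proof.
elim: k => [|k IHk]; first by rewrite !mulpow0 scale1r.
by rewrite !mulpowS IHk mulNZ linearZ scalerA -exprS.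
Qed.

Lemma npowS x k : npow mul x k.+1 = mulpow x k x.
Proof.
rewrite /npow /=; elim: k => [|k IHk]; first by rewrite mulpow0.
by rewrite mulpowS -IHk.
Qed.

Hypothesis mulC : forall x y, x ** y = y ** x.

Lemma nilpotent_mulpow :
  nilpotent_alg mul -> exists m, forall y z, mulpow y m z = 0.
Proof.
move=> [m nilm]; exists m => y z.
rewrite -(nilm z (nseq m y)) ?size_nseq //; elim: m {nilm} z => [|m IHm] z /=.
  by rewrite mulpow0.
by rewrite -IHm mulpowSr mulC.
Qed.

Hypothesis mulA : forall x y z, x ** (y ** z) = x ** y ** z.

Lemma mulCA x y z : x ** (y ** z) = y ** (x ** z).
Proof. by rewrite mulA (mulC x) -mulA. Qed.

Lemma mulpowM x k y z : mulpow x k (y ** z) = mulpow x k y ** z.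
Proof. by elim: k => [|k IHk]; rewrite ?mulpow0 // !mulpowS IHk mulA. Qed.

Lemma mulpow_ann a x k : (forall z, a ** z = 0) -> mulpow x k.+1 a = 0.
Proof. by move=> a0; rewrite mulpowSr mulC a0 linear0. Qed.

Lemma mulpow_addann a x k z :
  (forall z, a ** z = 0) -> mulpow (x + a) k z = mulpow x k z.
Proof.
move=> a0; elim: k => [|k IHk]; rewrite ?mulpow0 // !mulpowS IHk mulND a0.
exact: addr0.
Qed.

(** Used for polarization: the coefficient of t is the derivative of phi (y^k w) in direction z. In
    the induction one factor y + t z is absorbed into w. *)
Lemma mulpow_line_poly (phi : {scalar N}) y z k w :
  exists q : {poly F},
    [/\ forall t, q.[t] = phi (mulpow (y + t *: z) k w),
        q`_0 = phi (mulpow y k w)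
      & q`_1 = k%:R * phi (mulpow y k.-1 (z ** w))].
Proof.
elim: k w => [|k IHk] w.
  exists (phi w)%:P; split=> [t||]; rewrite ?hornerC ?coefC ?mulpow0 //=.
  by rewrite mul0r.
have [q1 [q1E q10 q11]] := IHk (y ** w).
have [q2 [q2E q20 q21]] := IHk (z ** w).
exists (q1 + 'X * q2); split=> [t||].
- rewrite hornerD hornerM hornerX q1E q2E mulpowSr mulND mulNZ.
  by rewrite 2!linearD /= 2!linearZ.
- by rewrite coefD coefXM addr0 q10 mulpowSr.
(* [k.-1] is truncated at k = 0, where the first summand contributes nothing; otherwise y is
   commuted past z and joins the power. *)
rewrite coefD coefXM q11 q20 /=; case: k {IHk q1 q1E q10 q11 q2 q2E q20 q21} => [|k].
  by rewrite mul0r add0r mul1r.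
by rewrite /= mulCA -mulpowSr -[k.+2]addn1 natrD mulrDl mul1r.
Qed.

End Powers.

Arguments mulpow : simpl never.

(** * The exponential series and derivations *)

Section Exponentials.
Context {F : fieldType} {N : vectType F} (mul : 'Hom(N, 'End(N))).
Local Notation "x ** y" := (mul x y) (at level 40, left associativity).
Local Notation mulexp x := (mulop mul (exp mul x)).
Hypotheses (mulC : forall x y, x ** y = y ** x)
           (mulA : forall x y z, x ** (y ** z) = x ** y ** z)
           (nilN : nilpotent_alg mul).

Lemma exp1_mulpow m x : (\dim {:N} <= m)%N ->
  exp1 mul x = \sum_(k < m) (k.+1`!%:R)^-1 *: mulpow mul x k x.
Proof.
move=> le_dm; rewrite (exp1E x mulC nilN le_dm) big_add1 /= big_mkord.
by apply: eq_bigr => k _; rewrite npowS.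
Qed.

Lemma mulexpE x z : mulexp x z = z + exp1 mul x ** z.
Proof. by rewrite /mulop /= scale1r add_lfunE id_lfunE. Qed.

(** The bound is strict because the identity term k = 0 takes one of the m places. *)
Lemma mulexp_mulpow m x z : (\dim {:N} < m)%N ->
  mulexp x z = \sum_(k < m) (k`!%:R)^-1 *: mulpow mul x k z.
Proof.
case: m => // m le_dm; rewrite mulexpE big_ord_recl /= fact0 invr1 scale1r.
rewrite mulpow0 (exp1_mulpow (m := m)) // linear_sum sum_lfunE; congr (_ + _).
by apply: eq_bigr => k _; rewrite mulNZ -mulpowM // -mulpowSr.
Qed.

Lemma exp1_addann a x : (forall z, a ** z = 0) ->
  exp1 mul (x + a) = exp1 mul x + a.
Proof.
(* Length dim + 1 keeps the sum nonempty, so that its linear term, the only one affected by a,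
   splits off. *)
move=> a0; rewrite !(exp1_mulpow _ (leqnSn _)) !big_ord_recl.
rewrite /= !mulpow0 invr1 !scale1r addrAC; congr (_ + _ + _).
apply: eq_bigr => k _; rewrite /bump /= add1n.
by rewrite mulpow_addann // linearD /= (mulpow_ann mulC x k a0) addr0.
Qed.

Lemma exp1_0 : exp1 mul 0 = 0.
Proof.
rewrite (exp1_mulpow _ (leqnn _)) big1 // => k _.
by rewrite linear0 scaler0.
Qed.

Section Derivation.
Hypothesis charF0 : [pchar F] =i pred0.
Variable D : 'End(N).
Hypothesis derD : derivation mul D.

Lemma derivation_mulpow x k :
  D (mulpow mul x k x) = k.+1%:R *: mulpow mul x k (D x).
Proof.
elim: k => [|k IHk]; first by rewrite !mulpow0 scale1r.
rewrite mulpowS derD IHk linearZ /= -mulpowS -[k.+2]addn1 natrD addrC.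
by rewrite mulC -mulpowM // -mulpowSr scalerDl scale1r.
Qed.

(** Leibniz termwise, with (k+1)/(k+1)! = 1/k!. *)
Lemma derivation_exp1 x : D (exp1 mul x) = mulexp x (D x).
Proof.
rewrite (exp1_mulpow _ (leqnSn _)) (mulexp_mulpow _ _ (ltnSn _)) linear_sum.
apply: eq_bigr => k _; rewrite linearZ /= derivation_mulpow scalerA mulrC.
by rewrite invf_factS.
Qed.

Lemma derivation_ann a : (forall z, a ** z = 0) -> forall z, D a ** z = 0.
Proof.
by move=> a0 z; have := derD a z; rewrite !a0 linear0 addr0 => <-.
Qed.

End Derivation.

End Exponentials.
(** The annihilator is a line F a, so [pi] is encoded by its coordinate [psi] along a; a projection
    fixes its range, whence psi a = 1. *)
Lemma admissible_coordinate {F : fieldType} {N : vectType F}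
    (mul : 'Hom(N, 'End(N))) (pi : 'End(N)) :
    admissible mul -> admissible_proj mul pi ->
  exists (a : N) (psi : {scalar N}),
    [/\ forall x, pi x = psi x *: a, psi a = 1, forall x, mul a x = 0
      & forall x, (forall y, mul x y = 0) -> x = psi x *: a].
Proof.
move=> [_ _ _ dimA] [pi_pi im_pi]; pose a := vpick (annihilator mul).
have nz_a : a != 0 by rewrite vpick0 -dimv_eq0 dimA.
have aA : a \in annihilator mul by apply: memv_pick.
have defA : annihilator mul = <[a]>%VS.
  apply/esym/eqP; rewrite eqEdim -memvE aA dimA dim_vline nz_a.
  exact: leqnn.
have freea : free [tuple a] by rewrite seq1_free.
pose psi : {scalar N} := coord [tuple a] ord0 \o pi.
have piE x : pi x = psi x *: a.
  have /vlineP[c pi_x] : pi x \in <[a]>%VS by rewrite -defA -im_pi memv_img ?memvf.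
  rewrite /psi /= pi_x linearZ /= -[X in coord _ _ X]/([tuple a]`_(@ord0 0)).
  by rewrite coord_free // mulr1.
have piA x : x \in annihilator mul -> pi x = x.
  by rewrite -im_pi => /memv_imgP[y _ ->]; rewrite -comp_lfunE pi_pi.
exists a, psi; split=> // [|x|x xy0].
- have /eqP := piE a; rewrite piA // -subr_eq0 -{1}[a]scale1r -scalerBl.
  by rewrite scaler_eq0 (negPf nz_a) orbF subr_eq0 => /eqP.
- exact/annihilatorP.
by rewrite -piE piA //; apply/annihilatorP.
Qed.

(** * The functional [psi], the hypersurface S and its tangent spaces *)

Section AdmissibleAlgebra.
Context {F : fieldType} {N : vectType F} (mul : 'Hom(N, 'End(N))).
Context (pi : 'End(N)) (a : N) (psi : {scalar N}).
Local Notation "x ** y" := (mul x y) (at level 40, left associativity).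
Local Notation mulexp x := (mulop mul (exp mul x)).
Hypotheses (charF0 : [pchar F] =i pred0)
           (mulC : forall x y, x ** y = y ** x)
           (mulA : forall x y z, x ** (y ** z) = x ** y ** z)
           (nilN : nilpotent_alg mul)
           (piE : forall x, pi x = psi x *: a)
           (psi_a : psi a = 1)
           (a_mul : forall x, a ** x = 0)
           (ann_a : forall x, (forall y, x ** y = 0) -> x = psi x *: a).

Lemma psi_pi x : psi (pi x) = psi x.
Proof. by rewrite piE linearZ /= psi_a mulr1. Qed.

Lemma pi_eq0 x : (pi x == 0) = (psi x == 0).
Proof.
apply/eqP/eqP=> [pix0 | psix0]; first by rewrite -psi_pi pix0 linear0.
by rewrite piE psix0 scale0r.
Qed.

(* A nonzero ideal of a nilpotent algebra meets the annihilator, hence an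
   ideal contained in the kernel of psi vanishes. *)
Lemma psi_nondegenerate x : psi x = 0 -> (forall y, psi (x ** y) = 0) -> x = 0.
Proof.
have [m nilm] := nilN; have {nilm} := nilm x; elim: m x => [|m IHm] x nilx.
  by move=> _ _; apply: (nilx [::]).
move=> psix0 psixy0; rewrite [x]ann_a ?psix0 ?scale0r // => z.
apply: IHm => // [s sz_s | y]; last by rewrite -mulA psixy0.
by rewrite -(nilx (z :: s)) //= sz_s.
Qed.

Lemma tangentE x z : (z \in tangent mul pi x) = (psi (mulexp x z) == 0).
Proof. by rewrite memv_ker comp_lfunE pi_eq0. Qed.

Lemma SpiE x : (x \in Spi mul pi) = (psi (exp1 mul x) == 0).
Proof. by rewrite inE pi_eq0. Qed.

Lemma tangent0 : tangent mul pi 0 = lker pi.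
Proof.
apply/vspaceP=> z; rewrite tangentE memv_ker pi_eq0 mulexpE exp1_0 //.
by rewrite linear0 zero_lfunE addr0.
Qed.

(* S is the graph of y |-> - psi (exp1 y) a over ker pi; the parametrization
   by all of N avoids choosing a complement of the annihilator. *)
Lemma aff_graph D v y : aff mul pi (affsub D v) ->
  psi (mulexp y (D y - psi (exp1 mul y) *: D a - v)) = 0.
Proof.
move=> affDv; pose b := - psi (exp1 mul y) *: a.
have b_mul z : b ** z = 0 by rewrite mulNZ a_mul scaler0.
have Sx : y + b \in Spi mul pi.
  rewrite SpiE exp1_addann // linearD /= /b linearZ /= psi_a mulr1.
  by rewrite subrr.
have := affDv _ Sx; rewrite tangentE affsubE => /eqP.
rewrite !mulexpE exp1_addann // mulND b_mul addr0.
by rewrite [D _]linearD /= [D b]linearZ /= scaleNr.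
Qed.

(** In the variable t this is psi (exp (t y) z). *)
Definition exp_poly (m : nat) (y z : N) : {poly F} :=
  \poly_(k < m) ((k`!%:R)^-1 * psi (mulpow mul y k z)).

(** In t this is psi (exp1 (t y)) divided by t. *)
Definition exp1_poly (m : nat) (y : N) : {poly F} :=
  \poly_(k < m) ((k.+1`!%:R)^-1 * psi (mulpow mul y k y)).

Lemma exp_poly_horner m y z t : (\dim {:N} < m)%N ->
  (exp_poly m y z).[t] = psi (mulexp (t *: y) z).
Proof.
move=> lt_dm; rewrite horner_poly (mulexp_mulpow _ _ _ _ _ lt_dm) //.
rewrite linear_sum; apply: eq_bigr => k _.
by rewrite mulpowZ linearZ /= linearZ /= mulrAC mulrA.
Qed.

Lemma exp1_poly_horner m y t : (\dim {:N} < m)%N ->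
  t * (exp1_poly m y).[t] = psi (exp1 mul (t *: y)).
Proof.
move=> /ltnW le_dm; rewrite horner_poly (exp1_mulpow mulC nilN _ le_dm).
rewrite linear_sum mulr_sumr; apply: eq_bigr => k _.
rewrite mulpowZ linearZ /= linearZ /= [mulpow _ _ _ (t *: y)]linearZ /= linearZ /=.
by rewrite [t ^+ _ * _]mulrCA [RHS]mulrCA -mulrA [psi _ * _]mulrC.
Qed.

(** * Tangent affine maps have derivations as linear parts *)

Section AffineTangent.
Variables (D : 'End(N)) (v : N).
Hypothesis affDv : aff mul pi (affsub D v).

Lemma aff_poly m y : (\dim {:N} < m)%N ->
  'X * exp_poly m y (D y) =
    'X * exp1_poly m y * exp_poly m y (D a) + exp_poly m y v.
Proof.
move=> lt_dm; apply/eqP; rewrite -subr_eq0; apply/eqP.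
apply: (poly_horner_eq0 charF0) => t.
rewrite !hornerE !exp_poly_horner // exp1_poly_horner //.
have := aff_graph (t *: y) affDv; rewrite !linearB /= !linearZ /= => <-.
by rewrite opprD addrA.
Qed.

(** If psi (y^(k+1)) is nonzero, [exp1_poly] has degree exactly k, while every [exp_poly] has degree
    at most k. The degrees in [aff_poly] then force [exp_poly m y (D a)] to be constant, and its
    coefficient of t is psi (y (D a)). *)
Lemma psi_mulDa_eq0_of_pow k :
    (forall y z, psi (mulpow mul y k.+1 z) = 0) ->
  forall y, psi (mulpow mul y k y) * psi (y ** D a) = 0.
Proof.
(* m exceeds the dimension, as evaluation requires, and k + 1, so that the coefficients 1 and k are
   not cut off. *)
move=> pow0 y; pose m := (maxn (\dim {:N}) k).+2.
have lt_dm : (\dim {:N} < m)%N by rewrite ltnS leqW // leq_maxl.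
have lt_km : (k.+1 < m)%N by rewrite !ltnS leq_maxr.
have pow_gt0 j z : (k < j)%N -> psi (mulpow mul y j z) = 0.
  by move=> lt_kj; rewrite -(subnKC lt_kj) mulpowD pow0.
have sz_exp z : (size (exp_poly m y z) <= k.+1)%N.
  apply/leq_sizeP=> j lt_kj; rewrite coef_poly; case: ifP => // _.
  by rewrite pow_gt0 // mulr0.
have [-> | nz_yk] := eqVneq (psi (mulpow mul y k y)) 0; first by rewrite mul0r.
have sz_exp1 : size (exp1_poly m y) = k.+1.
  apply/eqP; rewrite eqn_leq; apply/andP; split.
    apply/leq_sizeP=> j lt_kj; rewrite coef_poly; case: ifP => // _.
    by rewrite pow_gt0 // mulr0.
  rewrite ltnNge; apply: contra nz_yk => /leq_sizeP/(_ k (leqnn k))/eqP.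
  rewrite coef_poly (ltnW lt_km) mulf_eq0 invr_eq0.
  by rewrite (negPf (fact_neq0 charF0 _)).
have nz_exp1 : exp1_poly m y != 0 by rewrite -size_poly_gt0 sz_exp1.
suff sz_Da : (size (exp_poly m y (D a)) <= 1)%N.
  have /leq_sizeP/(_ 1%N (leqnn 1)) := sz_Da.
  by rewrite coef_poly /= mulpow1 invr1 mul1r => ->; rewrite mulr0.
have [-> | nz_Da] := eqVneq (exp_poly m y (D a)) 0; first by rewrite size_poly0.
have: (size ('X * (exp1_poly m y * exp_poly m y (D a)))%R <= k.+2)%N.
  have -> : 'X * (exp1_poly m y * exp_poly m y (D a)) =
      'X * exp_poly m y (D y) - exp_poly m y v.
    by rewrite (aff_poly y lt_dm) addrK mulrA.
  apply: leq_trans (size_polyD _ _) _; rewrite size_polyN geq_max.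
  apply/andP; split; last exact: leq_trans (sz_exp _) _.
  apply: leq_trans (size_polyMleq _ _) _; rewrite size_polyX addSn /= add1n.
  by rewrite ltnS sz_exp.
rewrite mulrC size_mulX ?mulf_neq0 // size_mul // sz_exp1 addSn /=.
by rewrite -addn1 -[k.+2]addn1 leq_add2r -[k.+1]addn1 leq_add2l.
Qed.

(* Downward induction on k: if psi (y^(k+1) z) vanishes identically, the
   degrees of the two sides of aff_poly force psi (y^(k+1)) psi (y (D a)) = 0
   for all y, hence psi (y^(k+1)) = 0 and, by polarization, psi (y^k z) = 0. *)
Lemma psi_mulDa z : psi (z ** D a) = 0.
Proof.
apply/eqP/contraT=> nz_zDa; have [m powm] := nilpotent_mulpow mulC nilN.
have: forall y w, psi (mulpow mul y m w) = 0 by move=> y w; rewrite powm linear0.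
elim: m {powm} => [pow0 | k IHk powk].
  by rewrite -(mulpow0 mul z (z ** D a)) pow0 eqxx in nz_zDa.
have {}powk : forall y, psi (mulpow mul y k y) = 0.
  move=> y.
  have [q1 [q1E _ _]] := mulpow_line_poly mulC mulA psi y z k y.
  have [q2 [q2E q20 _]] := mulpow_line_poly mulC mulA psi y z k z.
  (* The product identity on the line y + t z. The second factor has the nonzero t-coefficient psi
     (z (D a)), so the first one vanishes; its value at t = 0 is psi (y^(k+1)). *)
  pose q := (q1 + 'X * q2) * ((psi (y ** D a))%:P + 'X * (psi (z ** D a))%:P).
  have q0 : q = 0.
    apply: (poly_horner_eq0 charF0) => t; rewrite !hornerE q1E q2E.
    have := psi_mulDa_eq0_of_pow powk (y + t *: z).
    rewrite [mulpow _ _ _ _]linearD /= [mulpow _ _ _ (t *: z)]linearZ /=.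
    by rewrite mulND mulNZ !linearD /= !linearZ.
  have /eqP := q0; rewrite mulf_eq0 => /orP[/eqP q12 | /eqP q3].
    have := congr1 (fun p : {poly F} => p.[0]) q12.
    by rewrite !hornerE q1E scale0r addr0.
  have := congr1 (fun p : {poly F} => p`_1) q3.
  rewrite coefD coefXM !coefC /= add0r => zDa0.
  by rewrite zDa0 eqxx in nz_zDa.
apply: IHk => y w.
(* The coefficient of t in psi ((y + t w)^(k+1)) is (k+1) psi (y^k w). *)
have [q1 [q1E _ q11]] := mulpow_line_poly mulC mulA psi y w k y.
have [q2 [q2E q20 _]] := mulpow_line_poly mulC mulA psi y w k w.
have q0 : q1 + 'X * q2 = 0.
  apply: (poly_horner_eq0 charF0) => t; rewrite !hornerE q1E q2E.
  rewrite -(powk (y + t *: w)) [mulpow _ _ _ (y + _)]linearD /=.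
  by rewrite [mulpow _ _ _ (t *: w)]linearZ /= linearD /= linearZ.
have := congr1 (fun p : {poly F} => p`_1) q0.
rewrite coefD coefXM q11 q20 coef0 /=; case: k {powk q1E q11 q2E q20} => [|k].
  by rewrite mul0r add0r.
rewrite /= [w ** y]mulC -mulpowSr -[X in _ + X]mul1r -mulrDl natr1 => /eqP.
by rewrite mulf_eq0 (negPf (natrS_neq0 charF0 _)) => /eqP.
Qed.

Lemma aff_image_a : D a = psi (D a) *: a.
Proof.
apply/eqP; rewrite -subr_eq0; apply/eqP; apply: psi_nondegenerate => [|z].
  by rewrite linearB /= linearZ /= psi_a mulr1 subrr.
by rewrite mulNB mulNZ a_mul scaler0 subr0 mulC psi_mulDa.
Qed.

Let poly_bound k : (\dim {:N} < (\dim {:N} + k).+2)%N.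
Proof. by rewrite !ltnS leqW // leq_addr. Qed.

Lemma aff_psi_translation : psi v = 0.
Proof.
have := congr1 (fun p : {poly F} => p`_0) (aff_poly 0 (poly_bound 0)).
rewrite coefD -mulrA !coefXM /= add0r coef_poly /= fact0 invr1 mul1r mulpow0.
by move->.
Qed.

(** The coefficient of t^(k+1) in [aff_poly], multiplied by (k+1)!; since D a lies in F a, its
    [exp_poly] is constant. *)
Lemma aff_coef k y :
  k.+1%:R * psi (mulpow mul y k (D y)) =
    psi (mulpow mul y k y) * psi (D a) + psi (mulpow mul y k.+1 v).
Proof.
have := congr1 (fun p : {poly F} => p`_k.+1) (aff_poly y (poly_bound k)).
have -> : exp_poly (\dim {:N} + k).+2 y (D a) = (psi (D a))%:P.
  apply/polyP=> -[|j]; rewrite coef_poly coefC /=.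
    by rewrite fact0 invr1 mul1r mulpow0.
  rewrite mulpow_ann ?linear0 ?mulr0 ?if_same // => z.
  by rewrite aff_image_a mulNZ a_mul scaler0.
rewrite coefD -mulrA !coefXM coefMC /= !coef_poly !ltnS !leqW ?leq_addl //.
move/(congr1 (fun c => k.+1`!%:R * c)); rewrite mulrDr !mulrA.
have -> : k.+1`!%:R * (k`!%:R)^-1 = k.+1%:R :> F.
  by rewrite factS natrM mulfK ?fact_neq0.
by rewrite divff ?fact_neq0 // !mul1r.
Qed.

Lemma aff_psi_comm y : psi (D y) = psi y * psi (D a) + psi (y ** v).
Proof. by have := aff_coef 0 y; rewrite mul1r !mulpow0 mulpow1. Qed.

(** v is eliminated: [aff_psi_comm] at y^(k+1) has the right-hand side of [aff_coef]. *)
Lemma aff_psi_pow k y :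
  psi (D (mulpow mul y k y)) = k.+1%:R * psi (mulpow mul y k (D y)).
Proof. by rewrite aff_psi_comm aff_coef mulpowSr mulpowM. Qed.

Let psi_mulD x y : psi (D (x ** y)) = psi (x ** D y) + psi (y ** D x).
Proof.
have sq z : psi (D (z ** z)) = 2%:R * psi (z ** D z).
  by have := aff_psi_pow 1 z; rewrite !mulpow1.
apply: (mulfI (natrS_neq0 charF0 1)).
have := sq (x + y); rewrite !(mulND, linearD) /= !sq. rewrite (mulC y x) => e.
have -> : 2%:R * psi (D (x ** y)) = psi (D (x ** y)) + psi (D (x ** y)) by ring.
apply: (addIr (2%:R * psi (y ** D y))); apply: (addrI (2%:R * psi (x ** D x))).
by move: e; rewrite !addrA => ->; ring.
Qed.

Lemma aff_derivation : derivation mul D.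
Proof.
(* T is the Leibniz defect of psi D on triple products, zero on the diagonal by [aff_psi_pow] with k
   = 2. *)
pose T x y z := psi (D (x ** y ** z))
  - (psi (D x ** y ** z) + psi (D y ** x ** z) + psi (D z ** x ** y)).
have T0 x y z : T x y z = 0.
  apply: (trilinear_polarization charF0) => {x y z} [x x' y z|x y z|x y z|y].
  - by rewrite /T !(mulND, linearD) /=; ring.
  - rewrite /T (mulC y x) -(mulA (D z) y x) (mulC y x) mulA; ring.
  - have mulAC u : u ** y ** z = u ** z ** y by rewrite -!mulA (mulC y z).
    by rewrite /T (mulAC x) (mulAC (D x)); ring.
  have := aff_psi_pow 2 y; rewrite !(mulpowS, mulpow0) => e.
  rewrite /T -(mulA y y y) e -!mulA [D y ** _]mulC -mulA; ring.
move=> x y; apply/eqP; rewrite -subr_eq0; apply/eqP.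
apply: psi_nondegenerate => [|z].
  by rewrite linearB linearD /= psi_mulD (mulC (D x)); ring.
rewrite mulNB linearB mulND linearD /=.
(* Expanding psi (D (x y z)) once as a product of x y with z and once through T leaves psi (u z) = 0
   for the Leibniz defect u of D at x, y. *)
have := psi_mulD (x ** y) z; have := T0 x y z; rewrite /T.
rewrite (mulC z) (mulC (x ** y) (D z)) mulA => /eqP; rewrite subr_eq0 => /eqP -> e.
apply: (addrI (psi (D z ** x ** y))); rewrite addr0 addrA -e.
by rewrite (mulC x (D y)); ring.
Qed.

End AffineTangent.

(** * Description of aff(S) and of the translation vector *)

Lemma derivation_image_a D : derivation mul D -> D a = psi (D a) *: a.
Proof. by move=> derD; apply/ann_a/derivation_ann. Qed.

(** For a derivation, exp x (D x - v) = D (exp1 x) - v - (exp1 x) v, so tangency at x in S follows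
    from the linear identity at y = exp1 x, where psi y = 0. *)
Lemma affP D v :
  aff mul pi (affsub D v) <->
  [/\ derivation mul D, psi v = 0
    & forall y, psi (D y) = psi y * psi (D a) + psi (y ** v)].
Proof.
split=> [affDv | [derD psiv0 psiD] x].
  split; [exact: aff_derivation affDv | exact: aff_psi_translation affDv |].
  exact: aff_psi_comm.
rewrite SpiE tangentE affsubE => /eqP exp1x0.
rewrite linearB /= -derivation_exp1 // mulexpE linearB linearD /= psiD exp1x0.
by rewrite mul0r psiv0 !add0r subrr.
Qed.

(** D preserves the annihilator F a, so both sides of the commutator equation lie in F a; their
    coordinates give the identity of [affP]. *)
Lemma commutatorP D v : derivation mul D ->
  (v \in tangent mul pi 0 /\
     commutator pi D = (pi \o mulop mul (uext_inj v))%VF) <->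
  aff mul pi (affsub D v).
Proof.
move=> derD; have Da := derivation_image_a derD.
have commE y : (commutator pi D y == (pi \o mulop mul (uext_inj v))%VF y)
    = (psi (D y) == psi y * psi (D a) + psi (y ** v)).
  rewrite /commutator /mulop /= scale0r add0r add_lfunE opp_lfunE !comp_lfunE.
  rewrite !piE linearZ /= {1}Da scalerA -scalerBl -subr_eq0 -scalerBl scaler_eq0.
  have nz_a : a != 0.
    apply/eqP=> a0; have /eqP := psi_a.
    by rewrite a0 linear0 eq_sym oner_eq0.
  by rewrite (negPf nz_a) orbF -addrA -opprD subr_eq0 mulC.
rewrite tangent0 memv_ker pi_eq0 affP; split=> [[/eqP psiv0 eq_comm] | [_ -> psiD]].
  by split=> // y; apply/eqP; rewrite -commE eq_comm.
by split=> //; apply/lfunP=> y; apply/eqP; rewrite commE psiD.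
Qed.

(** By [affP], D determines psi (y v) for all y, and psi v = 0; nondegeneracy does the rest. *)
Lemma aff_translation_inj D v w :
  aff mul pi (affsub D v) -> aff mul pi (affsub D w) -> v = w.
Proof.
move=> /affP[_ psiv0 psiDv] /affP[_ psiw0 psiDw].
apply/eqP; rewrite -subr_eq0; apply/eqP; apply: psi_nondegenerate => [|y].
  by rewrite linearB /= psiv0 psiw0 subrr.
rewrite mulC linearB linearB /=; apply/eqP; rewrite subr_eq0; apply/eqP.
by apply: (addrI (psi y * psi (D a))); rewrite -psiDv psiDw.
Qed.

(* The form psi (v x) + psi v psi x is nondegenerate on all of N, hence
   represents every linear functional. *)
Lemma psi_riesz : exists rho : (N -> F) -> N,
  forall (phi : {scalar N}) x,
    psi (rho phi ** x) + psi (rho phi) * psi x = phi x.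
Proof.
pose e := vbasis {:N}.
have ext (phi chi : {scalar N}) :
    (forall i : 'I_(\dim {:N}), phi e`_i = chi e`_i) -> phi =1 chi.
  move=> eq_e x; rewrite (coord_vbasis (memvf x)) !linear_sum.
  by apply: eq_bigr => i _; rewrite !linearZ /= eq_e.
pose beta v : {scalar N} := psi \o (mul v + psi v *: \1)%VF.
have betaE v x : beta v x = psi (v ** x) + psi v * psi x.
  by rewrite /beta /= add_lfunE scale_lfunE id_lfunE linearD linearZ.
have beta_lin c v w x : beta (c *: v + w) x = c * beta v x + beta w x.
  by rewrite !betaE mulND mulNZ !linearD !linearZ /=; ring.
(* Recording functionals as vectors turns v |-> beta v into an endomorphism T of N, and an injective
   T is invertible. *)
pose vec (phi : N -> F) := \sum_(i < \dim {:N}) phi e`_i *: e`_i.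
have vec_inj phi chi : vec phi = vec chi ->
    forall i : 'I_(\dim {:N}), phi e`_i = chi e`_i.
  have e_free : free e := basis_free (vbasisP _).
  move=> eq_vec i; have := congr1 (coord e i) eq_vec.
  by rewrite !(coord_sum_free _ _ e_free).
have vec_beta_lin : linear (fun v => vec (beta v)).
  move=> c v w; rewrite /vec scaler_sumr -big_split; apply: eq_bigr => i _.
  by rewrite beta_lin scalerDl scalerA.
pose Tm := GRing.isLinear.Build F N N _ _ vec_beta_lin.
pose T : {linear N -> N} := HB.pack (fun v => vec (beta v)) Tm.
have T_inj : lker (linfun T) == 0%VS.
  rewrite -subv0; apply/subvP=> v; rewrite memv_ker lfunE /= memv0 => /eqP Tv0.
  have beta0 x : psi (v ** x) + psi v * psi x = 0.
    have /vec_inj/ext beta_eq : vec (beta v) = vec (beta 0).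
      exact: etrans Tv0 (esym (linear0 T)).
    by rewrite -betaE beta_eq betaE !linear0 zero_lfunE linear0 mul0r addr0.
  have psiv0 : psi v = 0.
    by have := beta0 a; rewrite mulC a_mul linear0 add0r psi_a mulr1.
  apply/eqP; apply: psi_nondegenerate => // x.
  by have := beta0 x; rewrite psiv0 mul0r addr0.
exists (fun phi => (linfun T)^-1%VF (vec phi)) => phi x; rewrite -betaE.
apply: ext => i; apply: (vec_inj (beta _) phi).
by have := lker0_lfunVK T_inj (vec phi); rewrite lfunE.
Qed.

(** * Closure of both spaces under linear combinations and brackets *)

Lemma derivation_linear c D E :
  derivation mul D -> derivation mul E -> derivation mul (c *: D + E).
Proof.
move=> derD derE x y; rewrite !add_lfunE !scale_lfunE derD derE.
rewrite mulND mulNZ [mul x (_ + _)]linearD /= [mul x (_ *: _)]linearZ /=.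
by rewrite scalerDr addrACA.
Qed.

Lemma derivation_commutator D E :
  derivation mul D -> derivation mul E -> derivation mul (commutator D E).
Proof.
move=> derD derE x y; rewrite !commutatorE derD derE.
rewrite [D (_ + _)]linearD [E (_ + _)]linearD /= !derD !derE.
rewrite mulNB [mul x (_ - _)]linearB /= !opprD !addrA.
rewrite [LHS](ACl (1 * 5 * 4 * 8 * (2 * 7) * (3 * 6)))/=.
by rewrite !subrr !addr0.
Qed.

Lemma aff_linear c A B : aff mul pi A -> aff mul pi B -> aff mul pi (c *: A + B).
Proof.
move=> affA affB x Sx; have -> : affmap_fun (c *: A + B) x
    = c *: affmap_fun A x + affmap_fun B x.
  by rewrite /affmap_fun /= add_lfunE scale_lfunE scalerDr addrACA.
by rewrite memvD ?memvZ ?affA ?affB.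
Qed.

(** Leibniz expresses psi (y (D w)) and psi (y (E v)) through the identities of [affP] for D and E;
    the terms psi (y v w) cancel by commutativity. *)
Lemma aff_affsub_commutator D v E w :
    aff mul pi (affsub D v) -> aff mul pi (affsub E w) ->
  aff mul pi (affsub (commutator D E) (D w - E v)).
Proof.
move=> /affP[derD psiv0 psiD] /affP[derE psiw0 psiE].
have Da := derivation_image_a derD; have Ea := derivation_image_a derE.
have DyE y : psi (y ** D w) =
    psi (y ** w) * psi (D a) + psi (y ** w ** v) - psi (D y ** w).
  by rewrite -psiD derD linearD /=; ring.
have EyE y : psi (y ** E v) =
    psi (y ** v) * psi (E a) + psi (y ** v ** w) - psi (E y ** v).
  by rewrite -psiE derE linearD /=; ring.
apply/affP; split; first exact: derivation_commutator.
  rewrite linearB /= psiD psiE psiv0 psiw0 (mulC v) !mul0r; ring.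
(* D and E both scale a, so they commute on it. *)
have comm_a : psi (commutator D E a) = 0.
  rewrite commutatorE; move: (psi (D a)) (psi (E a)) Da Ea => l m Da Ea.
  rewrite Da Ea [D (_ *: _)]linearZ [E (_ *: _)]linearZ /= Da Ea.
  by rewrite !scalerA mulrC subrr linear0.
move=> y; have -> : psi (y ** (D w - E v)) = psi (y ** D w) - psi (y ** E v).
  by rewrite [mul y _]linearB linearB.
rewrite comm_a commutatorE linearB /= psiD (psiE (D y)) psiE (psiD y) DyE EyE.
by rewrite -(mulA y w v) (mulC w v) mulA; ring.
Qed.

Lemma aff_bracket_closed A B :
  aff mul pi A -> aff mul pi B -> aff mul pi (aff_bracket A B).
Proof.
rewrite (affmap_affsub A) (affmap_affsub B) aff_bracket_affsub.
exact: aff_affsub_commutator.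
Qed.

Lemma derivation_translation : exists vD : 'End(N) -> N,
  forall D, derivation mul D -> aff mul pi (affsub D (vD D)).
Proof.
have [rho rhoE] := psi_riesz.
exists (fun D : 'End(N) => rho (psi \o (D - psi (D a) *: \1)%VF)) => D derD.
set v := rho _; have vE y : psi (v ** y) + psi v * psi y
    = psi (D y) - psi (D a) * psi y.
  rewrite rhoE /= add_lfunE opp_lfunE scale_lfunE id_lfunE.
  by rewrite linearB /= linearZ.
(* The represented functional vanishes at a. *)
have psiv0 : psi v = 0.
  have := vE a; rewrite mulC a_mul linear0 add0r psi_a !mulr1 => ->.
  exact: subrr.
apply/affP; split=> // y; have := vE y; rewrite psiv0 mul0r addr0 mulC => ->.
by ring.
Qed.

End AdmissibleAlgebra.

Theorem mainTheorem7 (F : fieldType) (N : vectType F)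
    (mul : 'Hom(N, 'End(N))) (pi : 'End(N)) :
  [pchar F] =i pred0 ->
  admissible mul ->
  admissible_proj mul pi ->
  (forall D : 'End(N),
     derivation mul D <-> exists v : N, aff mul pi (affsub D v)) /\
  tangent mul pi 0 = lker pi /\
  (exists vD : 'End(N) -> N,
     (forall D : 'End(N), derivation mul D ->
        unique (fun v : N => aff mul pi (affsub D v)) (vD D) /\
        unique (fun v : N => v \in tangent mul pi 0 /\
                  commutator pi D = (pi \o mulop mul (uext_inj v))%VF)
               (vD D)) /\
     lie_isomorphism
       (derivation mul) commutator
       (aff mul pi) aff_bracket
       (fun D : 'End(N) => affsub D (vD D))).
Proof.
move=> charF0 admN proj_pi; have [mulA mulC nilN _] := admN.
have [a [psi [piE psi_a a_mul ann_a]]] := admissible_coordinate admN proj_pi.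
have [vD vDP] :=
  derivation_translation charF0 mulC mulA nilN piE psi_a a_mul ann_a.
have aff_der D v : aff mul pi (affsub D v) -> derivation mul D.
  by case/(affP charF0 mulC mulA nilN piE psi_a a_mul ann_a).
have aff_inj D v w : aff mul pi (affsub D v) -> aff mul pi (affsub D w) -> v = w.
  exact: (aff_translation_inj charF0 mulC mulA nilN piE psi_a a_mul ann_a).
(* An element of aff(S) is determined by its linear part, so closure of aff(S) makes D |-> D -
   [vD D] linear and compatible with the brackets. *)
have vD_eq D v : aff mul pi (affsub D v) -> vD D = v.
  by move=> affDv; apply: aff_inj (vDP D (aff_der _ _ affDv)) affDv.
split=> [D|]; first by split=> [/vDP|[v /aff_der]] //; exists (vD D).
split; first exact: (tangent0 mulC nilN piE psi_a).
exists vD; split=> [D derD|].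
  have commP v := commutatorP charF0 mulC mulA nilN piE psi_a a_mul ann_a v derD.
  split; split; first exact: vDP; first exact: vD_eq.
    exact/commP/vDP.
  by move=> v /commP/vD_eq.
have br_closed A B : aff mul pi A -> aff mul pi B -> aff mul pi (aff_bracket A B).
  exact: (aff_bracket_closed charF0 mulC mulA nilN piE psi_a a_mul ann_a).
split.
- split.
    apply: lie_algebra_commutator.
    - by move=> x y; rewrite !zero_lfunE !linear0 zero_lfunE addr0.
    - exact: derivation_linear.
    exact: derivation_commutator.
  apply: lie_algebra_aff_bracket => //.
    by move=> x Sx; rewrite /affmap_fun zero_lfunE add0r mem0v.
  exact: aff_linear.
- exact: vDP.
- move=> c D E /vDP affD /vDP affE; rewrite affsubZ affsubD; congr affsub.
  by apply: vD_eq; rewrite -affsubD -affsubZ; apply: aff_linear.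
- move=> D E /vDP affD /vDP affE; rewrite aff_bracket_affsub; congr affsub.
  by apply: vD_eq; rewrite -aff_bracket_affsub; apply: br_closed.
split=> [D E _ _ [->] // | A affA].
move: affA; rewrite (affmap_affsub A) => affA; exists A.1; first exact: aff_der affA.
by rewrite (vD_eq _ _ affA).
Qed.
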